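(* Consider a nondegenerate model of walk with $d_{-1,1}\neq0$, $d_{1,-1}\neq0$ and $d_{-1,-1}=d_{-1,0}=d_{0,-1}=0$ (so that $\overline{E_t}$ has genus zero). An explicit parametrization $\phi=(x,y):\mathbb{P}^1(\mathbb{C})\to\overline{E_t}$ such that the induced automorphisms of $\mathbb{P}^1(\mathbb{C})$ are $$\tilde\iota_1(s)=\frac1s,\qquad \tilde\iota_2(s)=\frac{\lambda^2}{s}=\frac{q}{s},\qquad \tilde\sigma(s)=qs$$ for a certain $\lambda\in\mathbb{C}^*$ (with $q=\lambda^2$) is given by $$\phi(s)=\left(\frac{4\alpha_2(t)}{\sqrt{\alpha_3(t)^2-4\alpha_2(t)\alpha_4(t)}\,\big(s+\frac1s\big)-2\alpha_3(t)},\ \frac{4\beta_2(t)}{\sqrt{\beta_3(t)^2-4\beta_2(t)\beta_4(t)}\,\big(\frac{s}{\lambda}+\frac{\lambda}{s}\big)-2\beta_3(t)}\right).$$ Moreover, $x(0)=x(\infty)=a_1$, $x(1)=a_3$, $x(-1)=a_4$, $y(0)=y(\infty)=b_1$, $y(\lambda)=b_3$, $y(-\lambda)=b_4$.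
   Context: Weights: $d_{i,j}\in[0,1]$ for $(i,j)\in\{-1,0,1\}^2$, with $\sum d_{i,j}=1$; $t\in\,]0,1[$ is fixed and transcendental over $\mathbb{Q}(d_{i,j})$. Let $S(x,y)=\sum_{i,j}d_{i,j}x^iy^j$ and $K(x,y,t)=xy(1-tS(x,y))\in\mathbb{C}[x,y]$. The model is degenerate if $K(x,y,t)$ is reducible in $\mathbb{C}[x,y]$, or has $x$-degree $\le 1$, or has $y$-degree $\le 1$; otherwise it is nondegenerate. The kernel curve is $\overline{E_t}=\{([x_0:x_1],[y_0:y_1])\in\mathbb{P}^1(\mathbb{C})\times\mathbb{P}^1(\mathbb{C}) : \overline{K}(x_0,x_1,y_0,y_1,t)=0\}$ with $\overline{K}=x_0x_1y_0y_1-t\sum_{i,j=0}^2 d_{i-1,j-1}x_0^ix_1^{2-i}y_0^jy_1^{2-j}$. We identify $\mathbb{P}^1(\mathbb{C})$ with $\mathbb{C}\cup\{\infty\}$ via $z\mapsto[z:1]$, $\infty=[1:0]$. Write $S(x,y)=A_{-1}(x)\frac1y+A_0(x)+A_1(x)y=B_{-1}(y)\frac1x+B_0(y)+B_1(y)x$. The maps $\iota_1,\iota_2$ are the involutive automorphisms of $\overline{E_t}$ extending the rational maps given in affine coordinates by $(x,y)\mapsto\big(x,\frac{A_{-1}(x)}{A_1(x)y}\big)$ and $(x,y)\mapsto\big(\frac{B_{-1}(y)}{B_1(y)x},y\big)$, and $\sigma=\iota_2\circ\iota_1$. A parametrization of $\overline{E_t}$ is a surjective morphism $\phi:\mathbb{P}^1(\mathbb{C})\to\overline{E_t}$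 that is birational; the induced automorphisms $\tilde\iota_1,\tilde\iota_2,\tilde\sigma$ of $\mathbb{P}^1(\mathbb{C})$ are characterized by $\phi\circ\tilde\iota_k=\iota_k\circ\phi$ and $\phi\circ\tilde\sigma=\sigma\circ\phi$. In this family the discriminants of $\overline{K}$ with respect to $y$ and $x$ are $\Delta_1([x_0:x_1])=\alpha_2(t)x_0^2x_1^2+\alpha_3(t)x_0^3x_1+\alpha_4(t)x_0^4$ and $\Delta_2([y_0:y_1])=\beta_2(t)y_0^2y_1^2+\beta_3(t)y_0^3y_1+\beta_4(t)y_0^4$ with $$\alpha_2(t)=\beta_2(t)=1-2td_{0,0}+t^2d_{0,0}^2-4t^2d_{-1,1}d_{1,-1},$$ $$\alpha_3(t)=2t^2d_{1,0}d_{0,0}-2td_{1,0}-4t^2d_{0,1}d_{1,-1},\quad \beta_3(t)=2t^2d_{0,1}d_{0,0}-2td_{0,1}-4t^2d_{1,0}d_{-1,1},$$ $$\alpha_4(t)=t^2(d_{1,0}^2-4d_{1,1}d_{1,-1}),\quad \beta_4(t)=t^2(d_{0,1}^2-4d_{1,1}d_{-1,1}).$$ The double roots are $a_1=[0:1]$ of $\Delta_1$ and $b_1=[0:1]$ of $\Delta_2$. The other roots are: if $\alpha_4(t)\neq0$, $a_3=\big[-\alpha_3(t)-\sqrt{\alpha_3(t)^2-4\alpha_2(t)\alpha_4(t)}:2\alpha_4(t)\big]$ and $a_4=\big[-\alpha_3(t)+\sqrt{\alpha_3(t)^2-4\alpha_2(t)\alpha_4(t)}:2\alpha_4(t)\big]$;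 if $\alpha_4(t)=0$, $a_3=[1:0]$ and $a_4=[-\alpha_2(t):\alpha_3(t)]$; and $b_3,b_4$ are the roots of $\Delta_2$ given by the same formulas with each $\alpha_i$ replaced by $\beta_i$.
   Formalization: When α₄(t)=0 (resp. β₄(t)=0), the values x(±1) (resp. y(±λ)) are asserted only if the root √(α₃²) is taken to be α₃ (resp. √(β₃²)=β₃); with the positive root the labels a₃,a₄ (resp. b₃,b₄) are swapped and the claim is false. *)

(* Defs.v *)
From mathcomp Require Import all_boot all_order all_algebra.
From mathcomp Require Import reals.
From mathcomp.real_closed Require Import complex.

Set Implicit Arguments.
Unset Strict Implicit.
Unset Printing Implicit Defensive.

Import Order.TTheory GRing.Theory Num.Theory.
Local Open Scope ring_scope.
Local Open Scope complex_scope.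

(* P^1(C) = C u {oo}: [Some z] is [z : 1] and [None] is oo = [1 : 0]. *)
Definition P1 (C : fieldType) : Type := option C.

(* The point [x0 : x1]; meaningful only when (x0, x1) <> (0, 0). *)
Definition pt (C : fieldType) (x0 x1 : C) : P1 C :=
  if x1 == 0 then None else Some (x0 / x1).

(* The representatives (z, 1) and (1, 0). *)
Definition hc0 (C : fieldType) (p : P1 C) : C :=
  match p with Some z => z | None => 1 end.
Definition hc1 (C : fieldType) (p : P1 C) : C :=
  match p with Some _ => 1 | None => 0 end.

(* Homogeneous forms of degree n on P^1 and bihomogeneous forms of bidegree
   (m, n) on P^1 x P^1, given by their coefficients and evaluated at the above
   representatives. Vanishing at a point, and the point [F0 : F1] defined by
   two forms of the same (bi)degree, do not depend on the representatives. *)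
Definition form1 (C : fieldType) (n : nat) (F : nat -> C) (p : P1 C) : C :=
  \sum_(i < n.+1) F i * hc0 p ^+ i * hc1 p ^+ (n - i).

Definition form2 (C : fieldType) (m n : nat) (F : nat -> nat -> C)
    (p : P1 C * P1 C) : C :=
  \sum_(i < m.+1) \sum_(j < n.+1)
    F i j * hc0 p.1 ^+ i * hc1 p.1 ^+ (m - i)
          * hc0 p.2 ^+ j * hc1 p.2 ^+ (n - j).

(* Morphisms to P^1 from P^1, resp. from a locally closed E in P^1 x P^1:
   near every point, given by two forms of the same (bi)degree without common
   zero there. *)
Definition regular1 (C : fieldType) (f : P1 C -> P1 C) : Prop :=
  forall p, exists (n : nat) (F0 F1 : nat -> C),
    (form1 n F0 p, form1 n F1 p) <> (0, 0) /\
    (forall q, (form1 n F0 q, form1 n F1 q) <> (0, 0) ->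
       f q = pt (form1 n F0 q) (form1 n F1 q)).

Definition regular2 (C : fieldType) (E : P1 C * P1 C -> Prop)
    (f : P1 C * P1 C -> P1 C) : Prop :=
  forall p, E p -> exists (m n : nat) (F0 F1 : nat -> nat -> C),
    (form2 m n F0 p, form2 m n F1 p) <> (0, 0) /\
    (forall q, E q -> (form2 m n F0 q, form2 m n F1 q) <> (0, 0) ->
       f q = pt (form2 m n F0 q) (form2 m n F1 q)).

(* Only the values of iota on E matter. *)
Definition involutive_automorphism (C : fieldType) (E : P1 C * P1 C -> Prop)
    (iota : P1 C * P1 C -> P1 C * P1 C) : Prop :=
  [/\ forall p, E p -> E (iota p),
      regular2 E (fun p => (iota p).1),
      regular2 E (fun p => (iota p).2)
    & forall p, E p -> iota (iota p) = p].

(* phi has a rational inverse E --> P^1, p |-> [G0 p : G1 p]. A rational map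
   from an irreducible E to P^1 is always given by such a pair of bihomogeneous
   forms, not both identically zero on E. *)
Definition birational (C : fieldType) (E : P1 C * P1 C -> Prop)
    (phi : P1 C -> P1 C * P1 C) : Prop :=
  exists (m n : nat) (G0 G1 : nat -> nat -> C),
    let defined p := (form2 m n G0 p, form2 m n G1 p) <> (0, 0) in
    let psi p := pt (form2 m n G0 p) (form2 m n G1 p) in
    [/\ exists p, E p /\ defined p,
        forall s, defined (phi s) -> psi (phi s) = s
      & forall p, E p -> defined p -> phi (psi p) = p].

Definition parametrization (C : fieldType) (E : P1 C * P1 C -> Prop)
    (phi : P1 C -> P1 C * P1 C) : Prop :=
  [/\ regular1 (fun s => (phi s).1) /\ regular1 (fun s => (phi s).2),
      forall s, E (phi s),
      forall p, E p -> exists s, phi s = p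
    & birational E phi].

(* tphi is the map of P^1 induced by the map f of the curve. *)
Definition induces (C : fieldType) (phi : P1 C -> P1 C * P1 C)
    (f : P1 C * P1 C -> P1 C * P1 C) (tphi : P1 C -> P1 C) : Prop :=
  forall s, phi (tphi s) = f (phi s).

(* The maps s |-> c / s and s |-> c s of P^1, for c != 0. *)
Definition invP1 (C : fieldType) (c : C) (s : P1 C) : P1 C :=
  pt (c * hc1 s) (hc0 s).
Definition scaleP1 (C : fieldType) (c : C) (s : P1 C) : P1 C :=
  pt (c * hc0 s) (hc1 s).

Definition steps : seq int := [:: -1; 0; 1].

(* [d i j] is the weight d_{i,j}; only its values for i, j in {-1, 0, 1} are
   ever used. *)
Definition weights (R : realType) (d : int -> int -> R) : Prop :=
  (forall i j, i \in steps -> j \in steps -> 0 <= d i j <= 1) /\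
  \sum_(i <- steps) \sum_(j <- steps) d i j = 1.

(* The subfield Q(d_{i,j}) of R. *)
Inductive weight_field (R : realType) (d : int -> int -> R) : R -> Prop :=
| weight_field_gen i j of i \in steps & j \in steps : weight_field d (d i j)
| weight_field1 : weight_field d 1
| weight_fieldB x y of weight_field d x & weight_field d y :
    weight_field d (x - y)
| weight_fieldM x y of weight_field d x & weight_field d y :
    weight_field d (x * y)
| weight_fieldV x of weight_field d x : weight_field d x^-1.

Definition transcendental_over (R : realType) (F : R -> Prop) (t : R) : Prop :=
  forall p : {poly R}, (forall k, F p`_k) -> root p t -> p = 0.

(* K(x, y, t) = x y (1 - t S(x, y)) in C[x, y], with x = 'X the outer and
   y = 'Y the inner variable. *)
Definition kernel (R : realType) (d : int -> int -> R) (t : R) :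
    {poly {poly R[i]}} :=
  'X * 'Y - (t%:C)%:P%:P *
    \sum_(i < 3) \sum_(j < 3)
      ((d (i%:Z - 1) (j%:Z - 1))%:C)%:P%:P * 'X ^+ i * 'Y ^+ j.

Definition reducible (A : idomainType) (p : A) : Prop :=
  exists u v : A,
    [/\ u \isn't a GRing.unit, v \isn't a GRing.unit & p = u * v].

Definition degenerate (R : realType) (d : int -> int -> R) (t : R) : Prop :=
  [\/ reducible (kernel d t),
      (size (kernel d t) <= 2)%N
    | (sizeY (kernel d t) <= 2)%N].

Definition Kbar (R : realType) (d : int -> int -> R) (t : R)
    (x0 x1 y0 y1 : R[i]) : R[i] :=
  x0 * x1 * y0 * y1 - t%:C *
    \sum_(i < 3) \sum_(j < 3)
      (d (i%:Z - 1) (j%:Z - 1))%:C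
        * x0 ^+ i * x1 ^+ (2 - i) * y0 ^+ j * y1 ^+ (2 - j).

Definition kernel_curve (R : realType) (d : int -> int -> R) (t : R)
    (p : P1 R[i] * P1 R[i]) : Prop :=
  Kbar d t (hc0 p.1) (hc1 p.1) (hc0 p.2) (hc1 p.2) = 0.

(* S(x, y) = sum_j A_j(x) y^j = sum_i B_i(y) x^i. *)
Definition coefA (R : realType) (d : int -> int -> R) (j : int) (x : R[i]) :
    R[i] := \sum_(i <- steps) (d i j)%:C * x ^ i.
Definition coefB (R : realType) (d : int -> int -> R) (i : int) (y : R[i]) :
    R[i] := \sum_(j <- steps) (d i j)%:C * y ^ j.

Definition is_iota1 (R : realType) (d : int -> int -> R) (t : R)
    (iota : P1 R[i] * P1 R[i] -> P1 R[i] * P1 R[i]) : Prop :=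
  involutive_automorphism (kernel_curve d t) iota /\
  (forall x y : R[i], kernel_curve d t (Some x, Some y) ->
     x != 0 -> y != 0 -> coefA d 1 x != 0 ->
     iota (Some x, Some y) =
       (Some x, Some (coefA d (-1) x / (coefA d 1 x * y)))).

Definition is_iota2 (R : realType) (d : int -> int -> R) (t : R)
    (iota : P1 R[i] * P1 R[i] -> P1 R[i] * P1 R[i]) : Prop :=
  involutive_automorphism (kernel_curve d t) iota /\
  (forall x y : R[i], kernel_curve d t (Some x, Some y) ->
     x != 0 -> y != 0 -> coefB d 1 y != 0 ->
     iota (Some x, Some y) =
       (Some (coefB d (-1) y / (coefB d 1 y * x)), Some y)).

Section Discriminants.
Variables (R : realType) (d : int -> int -> R) (t : R).

Definition alpha2 : R :=
  1 - 2 * t * d 0 0 + t ^+ 2 * d 0 0 ^+ 2 - 4 * t ^+ 2 * d (-1) 1 * d 1 (-1).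
Definition alpha3 : R :=
  2 * t ^+ 2 * d 1 0 * d 0 0 - 2 * t * d 1 0 - 4 * t ^+ 2 * d 0 1 * d 1 (-1).
Definition alpha4 : R := t ^+ 2 * (d 1 0 ^+ 2 - 4 * d 1 1 * d 1 (-1)).

Definition beta2 : R := alpha2.
Definition beta3 : R :=
  2 * t ^+ 2 * d 0 1 * d 0 0 - 2 * t * d 0 1 - 4 * t ^+ 2 * d 1 0 * d (-1) 1.
Definition beta4 : R := t ^+ 2 * (d 0 1 ^+ 2 - 4 * d 1 1 * d (-1) 1).

End Discriminants.

(* The roots other than [0 : 1] of c2 x0^2 x1^2 + c3 x0^3 x1 + c4 x0^4, where r
   is the chosen square root of c3^2 - 4 c2 c4. For c4 = 0 the labels do not
   depend on r. *)
Definition root3 (C : fieldType) (c3 c4 r : C) : P1 C :=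
  if c4 != 0 then pt (- c3 - r) (2 * c4) else pt 1 0.
Definition root4 (C : fieldType) (c2 c3 c4 r : C) : P1 C :=
  if c4 != 0 then pt (- c3 + r) (2 * c4) else pt (- c2) c3.

(* Main.v *)
Require Import Defs.
From mathcomp Require Import all_boot all_order all_algebra.
From mathcomp Require Import reals.
From mathcomp.real_closed Require Import complex.
From mathcomp Require Import boolp ring lra.

Set Implicit Arguments.
Unset Strict Implicit.

Import Order.TTheory GRing.Theory Num.Theory.
Local Open Scope ring_scope.
Local Open Scope complex_scope.

(** Since d_{-1,-1}, d_{-1,0} and d_{0,-1} vanish, dividing the kernel by
    x^2 y^2 and putting u = 1/x, v = 1/y turns it into -Q(u, v), where
      Q(u, v) = a u^2 - c u v + b v^2 + e u + f v + g,
    a = t d_{-1,1}, b = t d_{1,-1}, c = 1 - t d_{0,0}, e = t d_{0,1},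
    f = t d_{1,0}, g = t d_{1,1}. So the curve is a conic in disguise. Its
    discriminant D = c^2 - 4ab is alpha_2, its centre is
    (- alpha_3 / 2D, - beta_3 / 2D), and in coordinates (U, V) at the centre it
    reads a U^2 - c U V + b V^2 + W / D = 0.

    Two elementary facts make it a smooth conic. First, D > 0, because
    t (d_{-1,1} + d_{1,-1}) < 1 - t d_{0,0} and 4 d_{-1,1} d_{1,-1} is at most
    the square of d_{-1,1} + d_{1,-1} ([alpha2_gt0]). Second, W != 0: otherwise
    the conic is a pair of lines through the centre and the kernel factors
    ([conic_kernel_reducible]), against nondegeneracy.

    The two discriminants under the square roots are 16 b W and 16 a W. With
    ra, rb their square roots and U = ra (s + 1/s) / 4D,
    V = rb (s/lambda + lambda/s) / 4D, the equation of the conic is an identity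
    in s as soon as b rb (lambda^2 + 1) = c ra lambda, a quadratic equation for
    lambda; the same equation with the roles of a, ra and b, rb exchanged
    follows. Solving for s in terms of s + 1/s and s/lambda + lambda/s, which is
    possible because D != 0 gives lambda^2 != 1, shows that s is an affine
    function of u and v: this inverts the parametrization away from the point
    (0, 0) of the curve, which is the image of 0 and oo.

    By construction x is invariant under s |-> 1/s and y under
    s |-> lambda^2/s. On the curve, 1/y(s) and 1/y(1/s) are the two
    roots of Q(1/x(s), _), so Vieta's formula for their product is the formula
    defining iota_1, at least for all but finitely many s; similarly for
    iota_2. Since iota_1 and iota_2 are morphisms, the identities extend to the
    remaining points ([regular_comp_eq]). *)

(** * Points of the projective line *)

Section ProjectiveLine.
Variable C : fieldType.
Implicit Types (a b k : C) (p s : P1 C).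

Lemma pt_eq a b a' b' : (a != 0) || (b != 0) -> (a' != 0) || (b' != 0) ->
  a * b' = a' * b -> pt a b = pt a' b'.
Proof.
rewrite /pt; have [->|b0] := eqVneq b 0; have [->|b'0] := eqVneq b' 0 => //=.
- by rewrite !orbF mulr0 => a0 _ /eqP; rewrite mulf_eq0 (negPf a0) (negPf b'0).
- rewrite !orbF mulr0 => _ a0 /esym/eqP.
  by rewrite mulf_eq0 (negPf a0) (negPf b0).
- by move=> _ _ h; congr Some; apply/eqP; rewrite eqr_div // h.
Qed.

Lemma pt_inj a b a' b' : (a != 0) || (b != 0) -> (a' != 0) || (b' != 0) ->
  pt a b = pt a' b' -> a * b' = a' * b.
Proof.
rewrite /pt; have [->|b0] := eqVneq b 0; have [->|b'0] := eqVneq b' 0 => //=.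
- by rewrite !mulr0.
- by move=> _ _ [] /eqP; rewrite eqr_div // => /eqP.
Qed.

Lemma pt_scale k a b : k != 0 -> pt (k * a) (k * b) = pt a b.
Proof.
move=> k0; rewrite /pt mulf_eq0 (negPf k0) /=; case: eqVneq => // b0.
by rewrite -mulf_div divff // mul1r.
Qed.

Lemma pt_hc p : pt (hc0 p) (hc1 p) = p.
Proof. by case: p => [z|]; rewrite /pt /= ?oner_eq0 ?divr1 ?eqxx. Qed.

Lemma hc_neq0 p : (hc0 p != 0) || (hc1 p != 0).
Proof. by case: p => [z|] /=; rewrite oner_neq0 ?orbT. Qed.

Lemma hc_pt a b : (a != 0) || (b != 0) ->
  exists2 k, k != 0 & hc0 (pt a b) = k * a /\ hc1 (pt a b) = k * b.
Proof.
rewrite /pt; have [->|b0] := eqVneq b 0; rewrite ?orbF /= => a0.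
  by exists a^-1; rewrite ?invr_eq0 // mulVf // mulr0.
by exists b^-1; rewrite ?invr_eq0 // mulVf // mulrC.
Qed.

Lemma neq00 a b : (a, b) <> (0, 0) -> (a != 0) || (b != 0).
Proof.
move=> h; rewrite -negb_and; apply/negP => /andP[/eqP a0 /eqP b0].
by apply: h; rewrite a0 b0.
Qed.

Lemma neq00V a b : (a != 0) || (b != 0) -> (a, b) <> (0, 0).
Proof. by move=> h [a0 b0]; move: h; rewrite a0 b0 eqxx. Qed.

End ProjectiveLine.

(** * Germs of maps to the projective line *)

Section Germs.
Variable C : numClosedFieldType.
Implicit Types (g h : C -> P1 C) (s : P1 C) (w : C).

(** A rational map C --> P^1 that is defined at 0, given by a pair of
    polynomials; N keeps away from the other points, where the pair may have
    common zeros or may fail to represent the map. *)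
Definition germ g : Prop := exists P0 P1 N : {poly C}, N.[0] != 0 /\
  forall w, N.[w] != 0 ->
    ((P0.[w] != 0) || (P1.[w] != 0)) /\ g w = pt P0.[w] P1.[w].

Lemma poly_neq0_at0 (P : {poly C}) : P.[0] != 0 -> P != 0.
Proof. by apply: contraNneq => ->; rewrite horner0. Qed.

Lemma poly_eq0_cofinite (P : {poly C}) (L : seq C) :
  (forall w, w \notin L -> P.[w] = 0) -> P = 0.
Proof.
move=> h; suff /eqP : P * \prod_(z <- L) ('X - z%:P) = 0.
  by rewrite mulf_eq0 (negPf (monic_neq0 (monic_prod_XsubC _ _ _))) orbF => /eqP.
set Q := (X in X = 0).
apply: (@roots_geq_poly_eq0 _ _ [seq i%:R | i <- iota 0 (size Q)]).
- apply/allP => w _; rewrite rootM root_prod_XsubC /root.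
  by case: (boolP (w \in L)) => wL; rewrite ?orbT // h ?eqxx.
- by rewrite map_inj_uniq ?iota_uniq // => i j /eqP; rewrite eqr_nat => /eqP.
- by rewrite size_map size_iota.
Qed.

(** Continuity at 0, algebraically: two maps [P0 : P1] and [Q0 : Q1] agree where
    P0 Q1 - Q0 P1 vanishes, and a polynomial vanishing almost everywhere
    vanishes at 0 too. *)
Lemma germ_eq g h (L : seq C) : germ g -> germ h ->
  (forall w, w \notin L -> g w = h w) -> g 0 = h 0.
Proof.
move=> [P0 [P1 [N [N0 gP]]]] [Q0 [Q1 [M [M0 hQ]]]] gh.
have /eqP : (P0 * Q1 - Q0 * P1) * N * M = 0.
  apply: (@poly_eq0_cofinite _ L) => w /gh ghw; rewrite !hornerM.
  have [->|/gP[nP Pw]] := eqVneq N.[w] 0; first by rewrite mulr0 mul0r.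
  have [->|/hQ[nQ Qw]] := eqVneq M.[w] 0; first by rewrite mulr0.
  rewrite !hornerE (@pt_inj _ P0.[w] P1.[w] Q0.[w] Q1.[w]) ?subrr ?mul0r //.
  by rewrite -Pw ghw.
rewrite -mulrA mulf_eq0 (mulf_eq0 N) (negPf (poly_neq0_at0 N0))
  (negPf (poly_neq0_at0 M0)) !orbF.
move=> /eqP PQ; have [nP ->] := gP _ N0; have [nQ ->] := hQ _ M0.
apply: pt_eq => //; apply/eqP; rewrite -subr_eq0.
by have := congr1 (fun P => P.[0]) PQ; rewrite !hornerE => ->.
Qed.

(** Changing the representatives of the two points multiplies all forms of
    bidegree (m, n) by one common factor, which is why k comes before F. *)
Lemma form2_pt m n (x0 x1 y0 y1 : C) :
  (x0 != 0) || (x1 != 0) -> (y0 != 0) || (y1 != 0) ->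
  exists2 k, k != 0 & forall F, form2 m n F (pt x0 x1, pt y0 y1) =
    k * \sum_(i < m.+1) \sum_(j < n.+1)
      F i j * x0 ^+ i * x1 ^+ (m - i) * y0 ^+ j * y1 ^+ (n - j).
Proof.
move=> /hc_pt[k k0 [hx0 hx1]] /hc_pt[l l0 [hy0 hy1]].
exists (k ^+ m * l ^+ n); first by rewrite mulf_neq0 // expf_neq0.
move=> F; rewrite /form2 mulr_sumr; apply: eq_bigr => i _.
rewrite mulr_sumr; apply: eq_bigr => j _ /=.
have -> : k ^+ m = k ^+ i * k ^+ (m - i) by rewrite -exprD subnKC // -ltnS.
have -> : l ^+ n = l ^+ j * l ^+ (n - j) by rewrite -exprD subnKC // -ltnS.
by rewrite hx0 hx1 hy0 hy1 !exprMn; ring.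
Qed.

Lemma form1_pt n (x0 x1 : C) : (x0 != 0) || (x1 != 0) ->
  exists2 k, k != 0 & forall F, form1 n F (pt x0 x1) =
    k * \sum_(i < n.+1) F i * x0 ^+ i * x1 ^+ (n - i).
Proof.
move=> /hc_pt[k k0 [hx0 hx1]]; exists (k ^+ n); first by rewrite expf_neq0.
move=> F; rewrite /form1 mulr_sumr; apply: eq_bigr => i _.
have -> : k ^+ n = k ^+ i * k ^+ (n - i) by rewrite -exprD subnKC // -ltnS.
by rewrite hx0 hx1 !exprMn; ring.
Qed.

(** Substituting two pairs of polynomials into the forms that represent f near
    (g 0, h 0) gives a pair of polynomials. *)
Lemma germ_regular2 (E : P1 C * P1 C -> Prop) f g h :
  regular2 E f -> germ g -> germ h -> (forall w, E (g w, h w)) ->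
  germ (fun w => f (g w, h w)).
Proof.
move=> fE [P0 [P1 [N [N0 gP]]]] [Q0 [Q1 [M [M0 hQ]]]] Egh.
have [m [n [F0 [F1 [F00 fF]]]]] := fE _ (Egh 0).
pose S (F : nat -> nat -> C) : {poly C} := \sum_(i < m.+1) \sum_(j < n.+1)
  (F i j)%:P * P0 ^+ i * P1 ^+ (m - i) * Q0 ^+ j * Q1 ^+ (n - j).
have Sw w : N.[w] != 0 -> M.[w] != 0 ->
    exists2 k, k != 0 & forall F, form2 m n F (g w, h w) = k * (S F).[w].
  move=> /gP[nP ->] /hQ[nQ ->].
  have [k k0 kF] := @form2_pt m n _ _ _ _ nP nQ.
  exists k => // F; rewrite kF; congr (_ * _).
  rewrite /S horner_sum; apply: eq_bigr => i _.
  by rewrite horner_sum; apply: eq_bigr => j _; rewrite !hornerE.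
(* whichever of the two polynomials does not vanish at 0 *)
pose V := if (S F0).[0] != 0 then S F0 else S F1.
have Vw w : V.[w] != 0 -> ((S F0).[w] != 0) || ((S F1).[w] != 0).
  by rewrite /V; case: ifP => _ ->; rewrite ?orbT.
exists (S F0), (S F1), (N * M * V); split.
  rewrite !hornerM !mulf_neq0 //; have [k k0 kF] := Sw 0 N0 M0.
  move: F00; rewrite !kF => /neq00; rewrite !mulf_eq0 (negPf k0) /= /V.
  by case: ifP.
move=> w; rewrite !hornerM !mulf_eq0 !negb_or => /andP[/andP[Nw Mw] /Vw nS].
split=> //; have [k k0 kF] := Sw w Nw Mw.
rewrite fF ?kF ?pt_scale //.
by apply: neq00V; rewrite !mulf_eq0 (negPf k0).
Qed.

(** The affine coordinate centred at s: w |-> s + w for s in C, and w |-> 1 / w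
    for s = oo. *)
Definition chart (s : P1 C) (w : C) : P1 C :=
  pt (hc0 s + w * hc1 s) (hc1 s + w * (1 - hc1 s)).

Lemma chart_neq0 s w :
  (hc0 s + w * hc1 s != 0) || (hc1 s + w * (1 - hc1 s) != 0).
Proof.
by case: s => [z|] /=; rewrite ?subrr ?mulr0 ?addr0 oner_neq0 ?orbT.
Qed.

Lemma chart0 s : chart s 0 = s.
Proof. by rewrite /chart !mul0r !addr0 pt_hc. Qed.

Lemma chart_cofinite s (L : seq C) :
  exists L' : seq C, forall w, w \notin L' ->
    exists2 z, z \notin L & chart s w = Some z.
Proof.
case: s => [z|].
  exists [seq l - z | l <- L] => w wL; exists (z + w).
    by apply: contra wL => zL; apply/mapP; exists (z + w) => //; ring.
  by rewrite /chart /pt /= subrr mulr0 addr0 oner_eq0 divr1 mulr1.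
exists (0 :: [seq l^-1 | l <- L]) => w; rewrite inE negb_or => /andP[w0 wL].
exists w^-1.
  by apply: contra wL => zL; apply/mapP; exists w^-1; rewrite ?invrK.
by rewrite /chart /pt /= subr0 mulr0 addr0 add0r mulr1 (negPf w0) div1r.
Qed.

Lemma germ_chart (f : P1 C -> P1 C) s :
  regular1 f -> germ (fun w => f (chart s w)).
Proof.
move=> /(_ s)[n [F0 [F1 [F00 fF]]]].
pose S (F : nat -> C) : {poly C} := \sum_(i < n.+1)
  (F i)%:P * ((hc0 s)%:P + 'X * (hc1 s)%:P) ^+ i *
    ((hc1 s)%:P + 'X * (1 - hc1 s)%:P) ^+ (n - i).
have Sw w : exists2 k, k != 0 & forall F, form1 n F (chart s w) = k * (S F).[w].
  have [k k0 kF] := @form1_pt n _ _ (chart_neq0 s w).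
  exists k => // F; rewrite kF; congr (_ * _).
  by rewrite /S horner_sum; apply: eq_bigr => i _; rewrite !hornerE.
(* whichever of the two polynomials does not vanish at 0 *)
pose V := if (S F0).[0] != 0 then S F0 else S F1.
exists (S F0), (S F1), V; split.
  have [k k0 kF] := Sw 0.
  move: F00; rewrite -[s in form1 _ _ s]chart0 -[s in form1 _ F1 s]chart0.
  rewrite !kF => /neq00.
  by rewrite !mulf_eq0 (negPf k0) /= /V; case: ifP.
move=> w Vw.
have nS : ((S F0).[w] != 0) || ((S F1).[w] != 0).
  by move: Vw; rewrite /V; case: ifP => _ ->; rewrite ?orbT.
split=> //; have [k k0 kF] := Sw w.
by rewrite fF ?kF ?pt_scale //; apply: neq00V; rewrite !mulf_eq0 (negPf k0).
Qed.

(** This extends to the whole projective line an identity f (phi s) = h s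
    between morphisms that has been computed for all but finitely many s: around any
    point, both sides are germs in the chart centred there. *)
Lemma regular_comp_eq (E : P1 C * P1 C -> Prop) f (phi : P1 C -> P1 C * P1 C)
    (h : P1 C -> P1 C) (L : seq C) :
  regular2 E f -> regular1 (fun s => (phi s).1) ->
  regular1 (fun s => (phi s).2) -> (forall s, E (phi s)) -> regular1 h ->
  (forall z, z \notin L -> f (phi (Some z)) = h (Some z)) ->
  forall s, f (phi s) = h s.
Proof.
move=> fE r1 r2 Ephi rh fh s.
have [L' hL'] := chart_cofinite s L.
rewrite -[s]chart0 [phi _]surjective_pairing.
pose G w := f ((phi (chart s w)).1, (phi (chart s w)).2).
apply: (@germ_eq G (fun w => h (chart s w)) L').
- apply: (germ_regular2 fE); [exact: germ_chart r1 | exact: germ_chart r2 |].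
  by move=> w; rewrite -surjective_pairing.
- exact: germ_chart.
- by move=> w /hL'[z zL ez]; rewrite /G -surjective_pairing ez fh.
Qed.

Lemma roots_seq (P : {poly C}) : P != 0 ->
  exists L : seq C, forall z, z \notin L -> P.[z] != 0.
Proof.
move=> P0; have [r rP] := closed_field_poly_normal P; exists r => z zr.
by rewrite rP -/(root _ z) rootZ ?lead_coef_eq0 // root_prod_XsubC.
Qed.

End Germs.

(** * Quotients of quadratic forms *)

Section QuadraticMaps.
Variable C : fieldType.
Implicit Types (k p m r c z : C) (s : P1 C).

(** The map s |-> k / (p s + m + r / s), in homogeneous coordinates; both
    coordinates of the parametrization have this form. *)
Definition qnum k s : C := k * (hc0 s * hc1 s).
Definition qden p m r s : C :=
  p * hc0 s ^+ 2 + m * (hc0 s * hc1 s) + r * hc1 s ^+ 2.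
Definition qmap k p m r s : P1 C := pt (qnum k s) (qden p m r s).

Lemma qmap_neq0 k p m r s : k != 0 -> p != 0 -> r != 0 ->
  (qnum k s != 0) || (qden p m r s != 0).
Proof.
move=> k0 p0 r0; rewrite /qnum /qden; case: s => [z|] /=.
  have [->|z0] := eqVneq z 0; last by rewrite mulr1 mulf_neq0.
  by rewrite mulr1 expr0n !mulr0 !add0r expr1n mulr1 r0 orbT.
by rewrite expr0n !mulr0 !addr0 expr1n mulr1 p0 orbT.
Qed.

Lemma qmap_regular k p m r : k != 0 -> p != 0 -> r != 0 ->
  regular1 (qmap k p m r).
Proof.
move=> k0 p0 r0 s.
exists 2%N, (fun i => if i == 1%N then k else 0),
  (fun i => if i == 0%N then r else if i == 1%N then m else p).
have e0 q : form1 2 (fun i => if i == 1%N then k else 0) q = qnum k q.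
  by rewrite /form1 !big_ord_recl big_ord0 /= /qnum; ring.
have e1 q : form1 2 (fun i => if i == 0%N then r else if i == 1%N then m else p)
    q = qden p m r q.
  by rewrite /form1 !big_ord_recl big_ord0 /= /qden; ring.
split=> [|q _]; rewrite e0 e1 //.
by apply: neq00V; apply: qmap_neq0.
Qed.

Lemma qmap_inv k p m r c s : c != 0 -> k != 0 -> p != 0 -> r != 0 ->
  qmap k p m r (invP1 c s) = qmap (k * c) r (m * c) (p * c ^+ 2) s.
Proof.
move=> c0 k0 p0 r0.
have nz : (c * hc1 s != 0) || (hc0 s != 0).
  by rewrite mulf_eq0 (negPf c0) /= orbC hc_neq0.
have [l l0 [h0 h1]] := hc_pt nz.
rewrite /qmap /qnum /qden /invP1 h0 h1 -[RHS](pt_scale _ _ (expf_neq0 2 l0)).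
by congr pt; ring.
Qed.

Lemma qmap_affine k p m r z : z != 0 ->
  qmap k p m r (Some z) = pt k (p * z + m + r / z).
Proof.
move=> z0; rewrite -(pt_scale _ _ z0) /qmap /qnum /qden /=.
by congr pt; field.
Qed.

Lemma qmap_zero k p m r : r != 0 -> qmap k p m r (Some 0) = pt 0 1.
Proof.
move=> r0; apply: pt_eq; rewrite /qnum /qden /= ?oner_neq0 ?orbT //; last by ring.
by rewrite !(mulr1, mulr0, expr0n, expr1n, add0r) r0 orbT.
Qed.

Lemma qmap_infty k p m r : p != 0 -> qmap k p m r None = pt 0 1.
Proof.
move=> p0; apply: pt_eq; rewrite /qnum /qden /= ?oner_neq0 ?orbT //; last by ring.
by rewrite !(mulr1, mulr0, expr0n, expr1n, addr0) p0 orbT.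
Qed.

Lemma invP1_comp c s : c != 0 -> invP1 c (invP1 1 s) = scaleP1 c s.
Proof.
move=> c0; have nz : (1 * hc1 s != 0) || (hc0 s != 0).
  by rewrite mul1r orbC hc_neq0.
have [l l0 [h0 h1]] := hc_pt nz.
rewrite /invP1 /scaleP1 h0 h1 -[RHS](pt_scale _ _ l0).
by congr pt; ring.
Qed.

End QuadraticMaps.

Arguments qnum {C}.
Arguments qden {C}.
Arguments qmap {C}.

(** * Parametrization of the curve *)

Section Conic.
Variable C : numClosedFieldType.
Variables a b c e f g : C.

(** In the coordinates x1 / x0 and y1 / y0 this is, up to sign, the conic
    a u^2 - c u v + b v^2 + e u + f v + g. *)
Definition conic_form (x0 x1 y0 y1 : C) : C :=
  c * x0 * x1 * y0 * y1 - a * x1 ^+ 2 * y0 ^+ 2 - b * x0 ^+ 2 * y1 ^+ 2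
  - e * x0 * x1 * y0 ^+ 2 - f * x0 ^+ 2 * y0 * y1 - g * x0 ^+ 2 * y0 ^+ 2.

Definition conic_curve (p : P1 C * P1 C) : Prop :=
  conic_form (hc0 p.1) (hc1 p.1) (hc0 p.2) (hc1 p.2) = 0.

Lemma conic_form_scale k l x0 x1 y0 y1 :
  conic_form (k * x0) (k * x1) (l * y0) (l * y1) =
  k ^+ 2 * l ^+ 2 * conic_form x0 x1 y0 y1.
Proof. by rewrite /conic_form; ring. Qed.

Lemma conic_curve_pt x0 x1 y0 y1 :
  (x0 != 0) || (x1 != 0) -> (y0 != 0) || (y1 != 0) ->
  conic_curve (pt x0 x1, pt y0 y1) <-> conic_form x0 x1 y0 y1 = 0.
Proof.
move=> /hc_pt[k k0 [kx0 kx1]] /hc_pt[l l0 [ly0 ly1]].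
rewrite /conic_curve /= kx0 kx1 ly0 ly1 conic_form_scale; split=> [/eqP|->].
  by rewrite mulf_eq0 (negPf (mulf_neq0 (expf_neq0 2 k0) (expf_neq0 2 l0))) => /eqP.
by rewrite mulr0.
Qed.

Definition disc : C := c ^+ 2 - 4 * a * b.
Definition al3 : C := - 2 * c * f - 4 * e * b.
Definition al4 : C := f ^+ 2 - 4 * g * b.
Definition be3 : C := - 2 * c * e - 4 * f * a.
Definition be4 : C := e ^+ 2 - 4 * g * a.
(** Up to the factor -4, the determinant of the symmetric matrix of the conic; it
    vanishes when the conic is a pair of lines. *)
Definition det : C :=
  c ^+ 2 * g - 4 * a * b * g + c * e * f + e ^+ 2 * b + f ^+ 2 * a.

Lemma al_discE : al3 ^+ 2 - 4 * disc * al4 = 16 * b * det.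
Proof. by rewrite /al3 /al4 /disc /det; ring. Qed.

Lemma be_discE : be3 ^+ 2 - 4 * disc * be4 = 16 * a * det.
Proof. by rewrite /be3 /be4 /disc /det; ring. Qed.

Variables ra rb : C.
Hypotheses (a0 : a != 0) (b0 : b != 0) (disc0 : disc != 0) (det0 : det != 0).
Hypotheses (ra2 : ra ^+ 2 = 16 * b * det) (rb2 : rb ^+ 2 = 16 * a * det).

Lemma ra_neq0 : ra != 0.
Proof.
have : ra ^+ 2 != 0 by rewrite ra2 !mulf_neq0 // pnatr_eq0.
by rewrite expf_eq0.
Qed.

Lemma rb_neq0 : rb != 0.
Proof.
have : rb ^+ 2 != 0 by rewrite rb2 !mulf_neq0 // pnatr_eq0.
by rewrite expf_eq0.
Qed.

(** The first equation is quadratic in lam. The second one follows from it, as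
    a ra^2 = b rb^2. *)
Lemma exists_lambda : exists lam : C,
  b * rb * (lam ^+ 2 + 1) = c * ra * lam /\
  a * ra * (lam ^+ 2 + 1) = c * rb * lam.
Proof.
have M0 : 2 * (b * rb) != 0 by rewrite !mulf_neq0 ?pnatr_eq0 ?rb_neq0.
pose del := sqrtC ((c * ra) ^+ 2 - 4 * (b * rb) ^+ 2).
have del2 : del ^+ 2 = (c * ra) ^+ 2 - 4 * (b * rb) ^+ 2 by rewrite sqrtCK.
pose lam := (c * ra + del) / (2 * (b * rb)).
have h : b * rb * (lam ^+ 2 + 1) = c * ra * lam.
  apply/eqP; rewrite -subr_eq0; apply/eqP.
  transitivity ((del ^+ 2 - ((c * ra) ^+ 2 - 4 * (b * rb) ^+ 2))
                 / (4 * (b * rb))).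
    by rewrite /lam; field; rewrite rb_neq0 b0.
  by rewrite del2 subrr mul0r.
exists lam; split=> //.
apply: (mulIf ra_neq0); rewrite [RHS]mulrAC [_ * rb * ra]mulrAC.
have -> : a * ra * (lam ^+ 2 + 1) * ra = a * (ra ^+ 2) * (lam ^+ 2 + 1) by ring.
have -> : c * ra * rb * lam = rb * (c * ra * lam) by ring.
rewrite -h ra2.
have -> : rb * (b * rb * (lam ^+ 2 + 1)) = b * rb ^+ 2 * (lam ^+ 2 + 1) by ring.
by rewrite rb2; ring.
Qed.

Variable lam : C.
Hypotheses (lamb : b * rb * (lam ^+ 2 + 1) = c * ra * lam)
           (lama : a * ra * (lam ^+ 2 + 1) = c * rb * lam).

Lemma lam_neq0 : lam != 0.
Proof.
apply: contraTneq (mulf_neq0 b0 rb_neq0) => l0; rewrite negbK.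
by move: lamb; rewrite l0 expr0n add0r mulr1 mulr0 => ->.
Qed.

(** The product of the equations [lamb] and [lama]. It determines lam^2 up to
    inversion, and shows that lam^2 = 1 only if the discriminant vanishes. *)
Lemma lam_disc : a * b * (lam ^+ 2 - 1) ^+ 2 = disc * lam ^+ 2.
Proof.
apply: (mulfI (mulf_neq0 ra_neq0 rb_neq0)); apply/eqP; rewrite -subr_eq0.
have -> : ra * rb * (a * b * (lam ^+ 2 - 1) ^+ 2) - ra * rb * (disc * lam ^+ 2) =
  (b * rb * (lam ^+ 2 + 1)) * (a * ra * (lam ^+ 2 + 1))
  - (c * ra * lam) * (c * rb * lam) by rewrite /disc; ring.
by rewrite lamb lama subrr.
Qed.

Lemma lam2_neq1 : lam ^+ 2 - 1 != 0.
Proof.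
apply: contraNneq (mulf_neq0 disc0 (expf_neq0 2 lam_neq0)) => l1.
by rewrite -lam_disc l1 expr0n mulr0.
Qed.

Definition xpar : P1 C -> P1 C := qmap (4 * disc) ra (- 2 * al3) ra.
Definition ypar : P1 C -> P1 C :=
  qmap (4 * disc * lam) rb (- 2 * be3 * lam) (rb * lam ^+ 2).
Definition par (s : P1 C) : P1 C * P1 C := (xpar s, ypar s).

Lemma disc4_neq0 : 4 * disc != 0.
Proof. by rewrite mulf_neq0 // pnatr_eq0. Qed.

Lemma disc4lam_neq0 : 4 * disc * lam != 0.
Proof. by rewrite mulf_neq0 ?disc4_neq0 ?lam_neq0. Qed.

Lemma rblam_neq0 : rb * lam ^+ 2 != 0.
Proof. by rewrite mulf_neq0 ?rb_neq0 ?expf_neq0 ?lam_neq0. Qed.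

Lemma xpar_regular : regular1 xpar.
Proof. by apply: qmap_regular; rewrite ?disc4_neq0 ?ra_neq0. Qed.

Lemma ypar_regular : regular1 ypar.
Proof. by apply: qmap_regular; rewrite ?disc4lam_neq0 ?rb_neq0 ?rblam_neq0. Qed.

(** The equation of the conic at the point with coordinates x1 / (4 disc m) and
    y1 / (4 disc lam m), after clearing denominators. Dropping the denominators
    makes it a polynomial identity in s0 and s1. Moving the origin to the centre
    removes the terms linear in ra or rb. With P = s0^2 + s1^2 and
    Q = s0^2 + lam^2 s1^2 the quadratic part becomes
    16 a b det (lam^2 P - Q) (P - Q) = - 16 a b det (lam^2 - 1)^2 m^2, which
    cancels the constant term by [lam_disc]. *)
Lemma conic_relation (s0 s1 : C) :
  let m := s0 * s1 in
  let x1 := ra * s0 ^+ 2 + - 2 * al3 * m + ra * s1 ^+ 2 in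
  let y1 := rb * s0 ^+ 2 + - 2 * be3 * lam * m + rb * lam ^+ 2 * s1 ^+ 2 in
  a * lam ^+ 2 * x1 ^+ 2 - c * lam * x1 * y1 + b * y1 ^+ 2
  + 4 * disc * lam ^+ 2 * m * e * x1 + 4 * disc * lam * m * f * y1
  + 16 * disc ^+ 2 * lam ^+ 2 * m ^+ 2 * g = 0.
Proof.
move=> m x1 y1.
pose P := s0 ^+ 2 + s1 ^+ 2; pose Q := s0 ^+ 2 + lam ^+ 2 * s1 ^+ 2.
transitivity (lam ^+ 2 * a * P ^+ 2 * (ra ^+ 2 - 16 * b * det)
  + b * Q ^+ 2 * (rb ^+ 2 - 16 * a * det)
  + P * Q * rb * (b * rb * (lam ^+ 2 + 1) - c * ra * lam)
  - b * (lam ^+ 2 + 1) * P * Q * (rb ^+ 2 - 16 * a * det)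
  - 16 * det * m ^+ 2 * (a * b * (lam ^+ 2 - 1) ^+ 2 - disc * lam ^+ 2)).
  by rewrite /P /Q /y1 /x1 /m /al3 /be3 /disc /det; ring.
by rewrite ra2 rb2 lamb lam_disc !subrr !mulr0 !subr0 !addr0.
Qed.

Lemma par_on_curve s : conic_curve (par s).
Proof.
apply/conic_curve_pt.
- by apply: qmap_neq0; rewrite ?disc4_neq0 ?ra_neq0.
- by apply: qmap_neq0; rewrite ?disc4lam_neq0 ?rb_neq0 ?rblam_neq0.
have := conic_relation (hc0 s) (hc1 s); rewrite /conic_form /qnum /qden.
set m := hc0 s * hc1 s; set x1 := _ + _ * hc1 s ^+ 2.
set y1 := _ + _ * hc1 s ^+ 2 => /= h.
transitivity (- 16 * disc ^+ 2 * m ^+ 2 * 0); last by rewrite mulr0.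
by rewrite -h; ring.
Qed.

Lemma raxrb : ra * rb * (lam ^+ 2 + 1) = 16 * c * lam * det.
Proof.
apply: (mulfI b0).
transitivity (ra * (b * rb * (lam ^+ 2 + 1))); first by ring.
rewrite lamb; transitivity (c * lam * ra ^+ 2); first by ring.
by rewrite ra2; ring.
Qed.

(** With P = s + 1/s and Q = s/lam + lam/s one has
    (lam^2 - 1) s = lam^2 P - lam Q and (lam^2 - 1) / s = lam Q - P. Expressing
    P and Q by the coordinates of the point gives s as [par_inv_num] over
    [par_inv_den], and 1/s as [par_inv_conum] over [par_inv_den]. *)
Definition par_inv_num (x0 x1 y0 y1 : C) : C :=
  lam ^+ 2 * rb * (4 * disc * x1 + 2 * al3 * x0) * y0
  - lam * ra * (4 * disc * y1 + 2 * be3 * y0) * x0.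
Definition par_inv_den (x0 y0 : C) : C := (lam ^+ 2 - 1) * ra * rb * x0 * y0.
Definition par_inv_conum (x0 x1 y0 y1 : C) : C :=
  lam * ra * (4 * disc * y1 + 2 * be3 * y0) * x0
  - rb * (4 * disc * x1 + 2 * al3 * x0) * y0.

(** That the two formulas give mutually inverse values is the equation of the
    conic. *)
Lemma par_inv_numM x0 x1 y0 y1 : conic_form x0 x1 y0 y1 = 0 ->
  par_inv_num x0 x1 y0 y1 * par_inv_conum x0 x1 y0 y1 = par_inv_den x0 y0 ^+ 2.
Proof.
move=> h; apply/eqP; rewrite -subr_eq0; apply/eqP.
pose xi := 4 * disc * x1 + 2 * al3 * x0.
pose eta := 4 * disc * y1 + 2 * be3 * y0.
transitivity (256 * lam ^+ 2 * det * disc ^+ 2 * conic_form x0 x1 y0 y1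
  + lam * xi * eta * x0 * y0 * (ra * rb * (lam ^+ 2 + 1) - 16 * c * lam * det)
  - lam ^+ 2 * xi ^+ 2 * y0 ^+ 2 * (rb ^+ 2 - 16 * a * det)
  - lam ^+ 2 * eta ^+ 2 * x0 ^+ 2 * (ra ^+ 2 - 16 * b * det)
  - (lam ^+ 2 - 1) ^+ 2 * x0 ^+ 2 * y0 ^+ 2 * rb ^+ 2 * (ra ^+ 2 - 16 * b * det)
  - (lam ^+ 2 - 1) ^+ 2 * x0 ^+ 2 * y0 ^+ 2 * 16 * b * det * (rb ^+ 2 - 16 * a * det)
  - 256 * det ^+ 2 * x0 ^+ 2 * y0 ^+ 2
    * (a * b * (lam ^+ 2 - 1) ^+ 2 - disc * lam ^+ 2)).
  rewrite /xi /eta /par_inv_num /par_inv_conum /par_inv_den /conic_form.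
  by rewrite /al3 /be3 /det /disc; ring.
by rewrite h raxrb ra2 rb2 lam_disc !subrr !mulr0 !subr0 !addr0.
Qed.

(** A point of the curve with x = 0 or y = 0 is (0, 0), the image of s = 0; for
    the others the formulas above provide s. *)
Lemma par_surjective p : conic_curve p -> exists s, par s = p.
Proof.
case: p => x y; rewrite /conic_curve /= => h.
have hx := hc_neq0 x; have hy := hc_neq0 y.
have [x0|x0] := eqVneq (hc0 x) 0.
  exists (Some 0); rewrite /par /xpar /ypar !qmap_zero ?ra_neq0 ?rblam_neq0 //.
  rewrite x0 eqxx /= in hx.
  have y0 : hc0 y = 0.
    apply/eqP; move/eqP: h.
    have -> : conic_form (hc0 x) (hc1 x) (hc0 y) (hc1 y)
      = - a * hc1 x ^+ 2 * hc0 y ^+ 2 by rewrite x0 /conic_form; ring.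
    by rewrite !mulf_eq0 oppr_eq0 (negPf a0) (negPf hx) /= orbb.
  rewrite y0 eqxx /= in hy.
  rewrite -(pt_hc x) -(pt_hc y) x0 y0; congr pair;
  by apply: pt_eq; rewrite ?oner_neq0 ?hx ?hy ?orbT // !mul0r.
have [y0|y0] := eqVneq (hc0 y) 0.
  rewrite y0 eqxx /= in hy; case/negP: x0; move/eqP: h.
  have -> : conic_form (hc0 x) (hc1 x) (hc0 y) (hc1 y)
    = - b * hc0 x ^+ 2 * hc1 y ^+ 2 by rewrite y0 /conic_form; ring.
  by rewrite !mulf_eq0 oppr_eq0 (negPf b0) (negPf hy) /= !orbF orbb.
have /par_inv_numM := h.
set x0' := hc0 x in x0 *; set x1 := hc1 x; set y0' := hc0 y in y0 *.
set y1 := hc1 y => hM.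
have den0 : par_inv_den x0' y0' != 0.
  by rewrite !mulf_neq0 ?lam2_neq1 ?ra_neq0 ?rb_neq0.
pose z := par_inv_num x0' x1 y0' y1 / par_inv_den x0' y0'.
pose z' := par_inv_conum x0' x1 y0' y1 / par_inv_den x0' y0'.
have zz' : z * z' = 1 by rewrite mulf_div hM expr2 divff // mulf_neq0.
have z0 : z != 0.
  by apply: contra_eq_neq zz' => ->; rewrite mul0r eq_sym oner_neq0.
have zV : z^-1 = z' by apply: (mulfI z0); rewrite divff.
have l1 := lam2_neq1; have l0 := lam_neq0; have r0 := ra_neq0; have s0 := rb_neq0.
exists (Some z); rewrite /par /xpar /ypar !qmap_affine // zV.
rewrite -(pt_hc x) -(pt_hc y) -/x0' -/x1 -/y0' -/y1; congr pair.
  apply: pt_eq; rewrite ?disc4_neq0 ?x0 //.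
  rewrite /z /z' /par_inv_num /par_inv_conum /par_inv_den; field.
  by rewrite l1 r0 s0 x0 y0.
apply: pt_eq; rewrite ?disc4lam_neq0 ?y0 //.
rewrite /z /z' /par_inv_num /par_inv_conum /par_inv_den; field.
by rewrite l1 r0 s0 x0 y0.
Qed.

(** [par_inv_num] and [par_inv_den] as arrays of coefficients of forms of
    bidegree (1, 1). *)
Definition par_inv0 (i j : nat) : C :=
  match i, j with
  | 0, 1 => lam ^+ 2 * rb * (4 * disc)
  | 1, 0 => - (lam * ra * (4 * disc))
  | 1, 1 => lam ^+ 2 * rb * (2 * al3) - lam * ra * (2 * be3)
  | _, _ => 0
  end.
Definition par_inv1 (i j : nat) : C :=
  match i, j with 1, 1 => (lam ^+ 2 - 1) * ra * rb | _, _ => 0 end.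

(** The inverse is defined exactly on the points of the curve other than
    (0, 0), since its denominator is a multiple of x0 y0. That it is also a right inverse follows
    from surjectivity. *)
Lemma par_birational : birational conic_curve par.
Proof.
exists 1%N, 1%N, par_inv0, par_inv1 => defined psi.
have key s : exists2 k, k != 0 & let m := hc0 s * hc1 s in
    form2 1 1 par_inv0 (par s) = k * m * hc0 s ^+ 2 /\
    form2 1 1 par_inv1 (par s) = k * m * m.
  have nx : (qnum (4 * disc) s != 0) || (qden ra (- 2 * al3) ra s != 0).
    by apply: qmap_neq0; rewrite ?disc4_neq0 ?ra_neq0.
  have ny : (qnum (4 * disc * lam) s != 0)
      || (qden rb (- 2 * be3 * lam) (rb * lam ^+ 2) s != 0).
    by apply: qmap_neq0; rewrite ?disc4lam_neq0 ?rb_neq0 ?rblam_neq0.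
  have [k k0 kF] := @form2_pt C 1 1 _ _ _ _ nx ny.
  exists (k * (16 * disc ^+ 2 * ra * rb * lam * (lam ^+ 2 - 1))).
    by rewrite !mulf_neq0 ?ra_neq0 ?rb_neq0 ?lam_neq0 ?lam2_neq1 ?pnatr_eq0.
  rewrite /par /xpar /ypar /qmap !kF !big_ord_recl !big_ord0 /= /qnum /qden.
  by split; ring.
have psiK s : defined (par s) -> psi (par s) = s.
  rewrite /defined /psi; have [k k0 [-> ->]] := key s.
  have [m0|m0 _] := eqVneq (hc0 s * hc1 s) 0; first by rewrite m0 !(mulr0, mul0r).
  rewrite -[RHS]pt_hc -[RHS](@pt_scale _ (k * (hc0 s * hc1 s) * hc0 s)).
    by congr pt; ring.
  by rewrite !mulf_neq0 //; move: m0; rewrite mulf_eq0 negb_or => /andP[].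
split=> //.
  exists (par (Some 1)); split; first exact: par_on_curve.
  rewrite /defined; have [k k0 [-> ->]] := key (Some 1).
  by apply: neq00V; rewrite /= !expr1n !mulr1 k0.
by move=> p /par_surjective[s <-] /psiK ->.
Qed.

Lemma par_parametrization : parametrization conic_curve par.
Proof.
split; first by split; [exact: xpar_regular | exact: ypar_regular].
- exact: par_on_curve.
- exact: par_surjective.
- exact: par_birational.
Qed.

Lemma xpar_ends : xpar (Some 0) = pt 0 1 /\ xpar None = pt 0 1.
Proof. by rewrite /xpar qmap_zero ?qmap_infty ?ra_neq0. Qed.

Lemma ypar_ends : ypar (Some 0) = pt 0 1 /\ ypar None = pt 0 1.
Proof. by rewrite /ypar qmap_zero ?qmap_infty ?rb_neq0 ?rblam_neq0. Qed.

Lemma xpar_inv s : xpar (invP1 1 s) = xpar s.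
Proof.
by rewrite /xpar qmap_inv ?oner_neq0 ?disc4_neq0 ?ra_neq0 // expr1n !mulr1.
Qed.

Lemma ypar_inv s : ypar (invP1 (lam ^+ 2) s) = ypar s.
Proof.
have l0 := expf_neq0 2 lam_neq0.
rewrite /ypar qmap_inv ?l0 ?disc4lam_neq0 ?rb_neq0 ?rblam_neq0 //.
rewrite /qmap -[RHS](pt_scale _ _ l0) /qnum /qden.
by congr pt; ring.
Qed.

Lemma ypar_inv1 s : ypar (invP1 1 s) =
  qmap (4 * disc * lam) (rb * lam ^+ 2) (- 2 * be3 * lam) rb s.
Proof.
rewrite /ypar qmap_inv ?oner_neq0 ?disc4lam_neq0 ?rb_neq0 ?rblam_neq0 //.
by rewrite expr1n !mulr1.
Qed.

Lemma xpar_invq s : xpar (invP1 (lam ^+ 2) s) =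
  qmap (4 * disc * lam ^+ 2) ra (- 2 * al3 * lam ^+ 2) (ra * lam ^+ 4) s.
Proof.
rewrite /xpar qmap_inv ?expf_neq0 ?lam_neq0 ?disc4_neq0 ?ra_neq0 //.
by rewrite -exprM.
Qed.

Definition qpoly (p m r : C) : {poly C} := p *: 'X^2 + m *: 'X + r%:P.

Lemma qpolyE (p m r z : C) : (qpoly p m r).[z] = qden p m r (Some z).
Proof.
rewrite /qpoly /qden /= hornerD hornerC hornerD !hornerZ hornerXn hornerX.
by ring.
Qed.

Lemma qpoly0 (p m r : C) : (qpoly p m r).[0] = r.
Proof. by rewrite qpolyE /qden /=; ring. Qed.

Lemma horner_quadratic (p q r : C) (P Q : {poly C}) z :
  (p *: P ^+ 2 + q *: (Q * P) + r *: Q ^+ 2).[z] =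
  p * P.[z] ^+ 2 + q * (Q.[z] * P.[z]) + r * Q.[z] ^+ 2.
Proof. by rewrite !hornerD !hornerZ !horner_exp hornerM. Qed.

(** For all but finitely many z, the point par z is in the affine domain where
    the formula for iota is available; there the claim is that 1 / y(z) and
    1 / y(1/z) have the product given by Vieta's formula for the conic viewed as
    a quadratic equation in v. *)
Lemma iota1_lift iota : regular2 conic_curve (fun p => (iota p).1) ->
  regular2 conic_curve (fun p => (iota p).2) ->
  (forall x y : C, conic_curve (Some x, Some y) -> x != 0 -> y != 0 ->
     a / x + e + g * x != 0 ->
     iota (Some x, Some y) =
       (Some x, Some (b * x / ((a / x + e + g * x) * y)))) ->
  induces par iota (invP1 1).
Proof.
move=> r1 r2 hi.
pose X1 := qpoly ra (- 2 * al3) ra.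
pose Y1 := qpoly rb (- 2 * be3 * lam) (rb * lam ^+ 2).
pose X0 : {poly C} := (4 * disc) *: 'X.
pose T := a *: X1 ^+ 2 + e *: (X0 * X1) + g *: X0 ^+ 2.
(* the roots of this polynomial are the z to avoid: T is the numerator of
   the denominator in the formula for iota *)
have N0 : 'X * X1 * Y1 * T != 0.
  rewrite !mulf_neq0 ?polyX_eq0 //; apply: poly_neq0_at0.
  - by rewrite qpoly0 ra_neq0.
  - by rewrite qpoly0 rblam_neq0.
  - rewrite horner_quadratic hornerZ hornerX qpoly0 !(mulr0, expr0n, mul0r, addr0).
    by rewrite mulf_neq0 ?expf_neq0 ?ra_neq0.
have [L hL] := roots_seq N0.
have gen z : z \notin L ->
    iota (par (Some z)) = (xpar (Some z), ypar (invP1 1 (Some z))).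
  move=> /hL; rewrite !hornerM !mulf_eq0 !negb_or hornerX /X1 /Y1 !qpolyE.
  rewrite horner_quadratic hornerZ hornerX qpolyE.
  have := conic_relation z 1; have := par_on_curve (Some z).
  rewrite ypar_inv1 /par /xpar /ypar /qmap /qnum /qden /= expr1n !mulr1.
  set x1 := ra * _ + _ + ra; set y1 := rb * _ + _ + rb * _.
  set y1' := _ + rb => hE hR /andP[/andP[/andP[z0 x10] y10] T0].
  have x00 : 4 * disc * z != 0 by rewrite mulf_neq0 ?disc4_neq0.
  have y00 : 4 * disc * lam * z != 0 by rewrite mulf_neq0 ?disc4lam_neq0.
  have l0 := lam_neq0.
  set Tz := (X in X != 0) in T0.
  (* the formula for the sum of the two roots, combined with the equation
     of the conic at one of them, gives their product *)
  have vieta : b * y1 * y1' = lam ^+ 2 * Tz.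
    apply/eqP; rewrite -subr_eq0; apply/eqP.
    transitivity (y1 * (z ^+ 2 + 1) * (b * rb * (lam ^+ 2 + 1) - c * ra * lam)
                  - 0); last by rewrite lamb subrr mulr0 subr0.
    by rewrite -hR /Tz /y1' /y1 /x1 /al3 /be3 /disc; ring.
  have y1'0 : y1' != 0.
    apply: contraNneq (mulf_neq0 (expf_neq0 2 l0) T0) => y1'0.
    by rewrite -vieta y1'0 mulr0.
  move: hE; rewrite /pt (negPf x10) (negPf y10) (negPf y1'0) => hE.
  have TE : a / (4 * disc * z / x1) + e + g * (4 * disc * z / x1)
      = Tz / (x1 * (4 * disc * z)).
    by rewrite /Tz; field; rewrite disc0 z0 x10.
  rewrite hi //.
  - congr (Some _, Some _); rewrite TE.
    have -> : Tz = b * y1 * y1' / lam ^+ 2 by rewrite vieta mulrC mulKf ?expf_neq0.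
    by field; rewrite disc0 z0 x10 y10 y1'0 l0 b0.
  - by rewrite mulf_neq0 ?x00 ?y00 ?invr_eq0.
  - by rewrite mulf_neq0 ?x00 ?y00 ?invr_eq0.
  - by rewrite TE (mulf_neq0 T0 (invr_neq0 (mulf_neq0 x10 x00))).
have ry : regular1 (fun s => ypar (invP1 1 s)).
  move=> s; have [n [F0 [F1 [h0 h1]]]] := @qmap_regular C (4 * disc * lam)
    (rb * lam ^+ 2) (- 2 * be3 * lam) rb disc4lam_neq0 rblam_neq0 rb_neq0 s.
  by exists n, F0, F1; split=> // q /h1; rewrite ypar_inv1.
move=> s; rewrite [RHS]surjective_pairing /par xpar_inv; congr pair.
- apply/esym; move: s; apply: (@regular_comp_eq _ _ _ par xpar L r1) => //.
  + exact: xpar_regular.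
  + exact: ypar_regular.
  + exact: par_on_curve.
  + exact: xpar_regular.
  + by move=> z /gen ->.
- apply/esym; move: s; apply: (@regular_comp_eq _ _ _ par _ L r2) => //.
  + exact: xpar_regular.
  + exact: ypar_regular.
  + exact: par_on_curve.
  + by move=> z /gen ->.
Qed.

(** The same argument with the roles of u and v exchanged; replacing z by
    lam^2 / z is what preserves y. *)
Lemma iota2_lift iota : regular2 conic_curve (fun p => (iota p).1) ->
  regular2 conic_curve (fun p => (iota p).2) ->
  (forall x y : C, conic_curve (Some x, Some y) -> x != 0 -> y != 0 ->
     b / y + f + g * y != 0 ->
     iota (Some x, Some y) =
       (Some (a * y / ((b / y + f + g * y) * x)), Some y)) ->
  induces par iota (invP1 (lam ^+ 2)).
Proof.
move=> r1 r2 hi.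
pose X1 := qpoly ra (- 2 * al3) ra.
pose Y1 := qpoly rb (- 2 * be3 * lam) (rb * lam ^+ 2).
pose Y0 : {poly C} := (4 * disc * lam) *: 'X.
pose T := b *: Y1 ^+ 2 + f *: (Y0 * Y1) + g *: Y0 ^+ 2.
(* the roots of this polynomial are the z to avoid: T is the numerator of
   the denominator in the formula for iota *)
have N0 : 'X * X1 * Y1 * T != 0.
  rewrite !mulf_neq0 ?polyX_eq0 //; apply: poly_neq0_at0.
  - by rewrite qpoly0 ra_neq0.
  - by rewrite qpoly0 rblam_neq0.
  - rewrite horner_quadratic hornerZ hornerX qpoly0 !(mulr0, expr0n, mul0r, addr0).
    by rewrite mulf_neq0 ?expf_neq0 ?rblam_neq0.
have [L hL] := roots_seq N0.
have gen z : z \notin L ->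
    iota (par (Some z)) = (xpar (invP1 (lam ^+ 2) (Some z)), ypar (Some z)).
  move=> /hL; rewrite !hornerM !mulf_eq0 !negb_or hornerX /X1 /Y1 !qpolyE.
  rewrite horner_quadratic hornerZ hornerX qpolyE.
  have := conic_relation z 1; have := par_on_curve (Some z).
  rewrite xpar_invq /par /xpar /ypar /qmap /qnum /qden /= expr1n !mulr1.
  set x1 := ra * _ + _ + ra; set y1 := rb * _ + _ + rb * _.
  set x1' := ra * _ + _ + ra * _ => hE hR /andP[/andP[/andP[z0 x10] y10] T0].
  have x00 : 4 * disc * z != 0 by rewrite mulf_neq0 ?disc4_neq0.
  have y00 : 4 * disc * lam * z != 0 by rewrite mulf_neq0 ?disc4lam_neq0.
  have l0 := lam_neq0.
  set Tz := (X in X != 0) in T0.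
  (* the formula for the sum of the two roots, combined with the equation
     of the conic at one of them, gives their product *)
  have vieta : a * x1 * x1' = Tz.
    apply/eqP; rewrite -subr_eq0; apply/eqP.
    transitivity (x1 * (z ^+ 2 + lam ^+ 2) * (a * ra * (lam ^+ 2 + 1) - c * rb * lam)
                  - 0); last by rewrite lama subrr mulr0 subr0.
    by rewrite -hR /Tz /x1' /y1 /x1 /al3 /be3 /disc; ring.
  have x1'0 : x1' != 0.
    by apply: contraNneq T0 => x1'0; rewrite -vieta x1'0 mulr0.
  move: hE; rewrite /pt (negPf x10) (negPf y10) (negPf x1'0) => hE.
  have TE : b / (4 * disc * lam * z / y1) + f + g * (4 * disc * lam * z / y1)
      = Tz / (y1 * (4 * disc * lam * z)).
    by rewrite /Tz; field; rewrite disc0 l0 z0 y10.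
  rewrite hi //.
  - congr (Some _, Some _); rewrite TE -vieta.
    by field; rewrite disc0 z0 x10 y10 x1'0 l0 a0.
  - by rewrite mulf_neq0 ?x00 ?y00 ?invr_eq0.
  - by rewrite mulf_neq0 ?x00 ?y00 ?invr_eq0.
  - by rewrite TE (mulf_neq0 T0 (invr_neq0 (mulf_neq0 y10 y00))).
have rx : regular1 (fun s => xpar (invP1 (lam ^+ 2) s)).
  have r0 : ra * lam ^+ 4 != 0 by rewrite mulf_neq0 ?expf_neq0 ?ra_neq0 ?lam_neq0.
  have k0 : 4 * disc * lam ^+ 2 != 0.
    by rewrite mulf_neq0 ?expf_neq0 ?disc4_neq0 ?lam_neq0.
  move=> s; have [n [F0 [F1 [h0 h1]]]] := @qmap_regular C _
    ra (- 2 * al3 * lam ^+ 2) _ k0 ra_neq0 r0 s.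
  by exists n, F0, F1; split=> // q /h1; rewrite xpar_invq.
move=> s; rewrite [RHS]surjective_pairing /par ypar_inv; congr pair.
- apply/esym; move: s; apply: (@regular_comp_eq _ _ _ par _ L r1) => //.
  + exact: xpar_regular.
  + exact: ypar_regular.
  + exact: par_on_curve.
  + by move=> z /gen ->.
- apply/esym; move: s; apply: (@regular_comp_eq _ _ _ par ypar L r2) => //.
  + exact: xpar_regular.
  + exact: ypar_regular.
  + exact: par_on_curve.
  + exact: ypar_regular.
  + by move=> z /gen ->.
Qed.

End Conic.

(** * Degenerate kernels *)

Section Reducibility.
Variable C : numClosedFieldType.
Variables a b c e f g : C.
Hypotheses (a0 : a != 0) (disc0 : disc a b c != 0).

Definition conic_kernel : {poly {poly C}} :=
  c%:P%:P * 'X * 'Y - a%:P%:P * 'Y ^+ 2 - b%:P%:P * 'X ^+ 2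
  - e%:P%:P * 'X * 'Y ^+ 2 - f%:P%:P * 'X ^+ 2 * 'Y
  - g%:P%:P * 'X ^+ 2 * 'Y ^+ 2.

Lemma nonunit_vanishing (P : {poly {poly C}}) :
  P.[0].[0] = 0 -> P \isn't a GRing.unit.
Proof.
move=> P0; apply/negP => /mulrV /(congr1 (fun Q => Q.[0].[0])).
by rewrite !hornerM P0 mul0r !hornerC => /eqP; rewrite eq_sym oner_eq0.
Qed.

(** When det = 0 the conic is the pair of lines
    a (u - p v - w) (u - p' v - w') = 0 through its centre, p and p' being the
    roots of a p^2 - c p + b = 0. These are distinct as disc != 0, which allows
    solving for w and w'. Multiplying each line by x y gives the factors of the
    kernel. *)
Lemma conic_kernel_reducible : det a b c e f g = 0 -> reducible conic_kernel.
Proof.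
move=> W0; pose del := sqrtC (disc a b c).
have del2 : del ^+ 2 = disc a b c by rewrite sqrtCK.
have del0 : del != 0 by rewrite sqrtC_eq0.
pose p := (c + del) / (2 * a); pose p' := (c - del) / (2 * a).
pose w := - (f + p * e) / del; pose w' := (f + p' * e) / del.
have cE : c = a * (p + p') by rewrite /p /p'; field.
have bE : b = a * (p * p').
  transitivity ((c ^+ 2 - del ^+ 2) / (4 * a)); last by rewrite /p /p'; field.
  by rewrite del2 /disc; field.
have eE : e = - a * (w + w') by rewrite /w /w' /p /p'; field; rewrite del0.
have fE : f = a * (p * w' + p' * w).
  by rewrite /w /w' /p /p'; field; rewrite del0.
have gE : g = a * (w * w').
  apply/eqP; rewrite -subr_eq0; apply/eqP.
  transitivity ((del ^+ 2 * g
      - - (a * (f ^+ 2 + f * e * (p + p') + e ^+ 2 * (p * p')))) / del ^+ 2).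
    by rewrite /w /w'; field.
  transitivity (det a b c e f g / del ^+ 2); last by rewrite W0 mul0r.
  congr (_ / _); rewrite del2 /det /disc.
  transitivity (c ^+ 2 * g - 4 * a * b * g + a * f ^+ 2
      + f * e * (a * (p + p')) + e ^+ 2 * (a * (p * p'))); first by ring.
  by rewrite -cE -bE; ring.
exists (- a%:P%:P * ('Y - p%:P%:P * 'X - w%:P%:P * 'X * 'Y)),
  ('Y - p'%:P%:P * 'X - w'%:P%:P * 'X * 'Y); split.
- by apply: nonunit_vanishing; rewrite !hornerE ?(subr0, oppr0, mulr0).
- by apply: nonunit_vanishing; rewrite !hornerE ?(subr0, oppr0, mulr0).
rewrite /conic_kernel cE bE eE fE gE.
clearbody p p' w w'.
rewrite !(polyCM, polyCD, polyCN); ring.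
Qed.

End Reducibility.

(** * The kernel of the walk *)

(** Both values come from (- c3 - r) (2 r - 2 c3) = 2 (c3^2 - r^2) = 8 c2 c4 and
    its analogue for - r. *)
Lemma roots_of_discriminant (C : numClosedFieldType) (c2 c3 c4 r : C) :
  c2 != 0 -> r ^+ 2 = c3 ^+ 2 - 4 * c2 * c4 -> c4 != 0 \/ r = c3 ->
  pt (4 * c2) (2 * r - 2 * c3) = root3 c3 c4 r /\
  pt (4 * c2) (- 2 * r - 2 * c3) = root4 c2 c3 c4 r.
Proof.
move=> c20 r2; have k0 : 4 * c2 != 0 by rewrite mulf_neq0 ?pnatr_eq0.
have c4E : 4 * c2 * c4 = c3 ^+ 2 - r ^+ 2 by rewrite r2; ring.
rewrite /root3 /root4; have [c40 [//|rE]|c40 _] /= := eqVneq c4 0.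
  rewrite rE subrr; split; first by rewrite /pt !eqxx.
  rewrite -[RHS](@pt_scale _ (-4)) ?oppr_eq0 ?pnatr_eq0 //.
  by congr pt; ring.
have d0 : 2 * c4 != 0 by rewrite mulf_neq0 ?pnatr_eq0.
split; apply: pt_eq; rewrite ?k0 ?d0 ?orbT //.
- by transitivity (2 * (4 * c2 * c4)); [ring | rewrite c4E; ring].
- by transitivity (2 * (4 * c2 * c4)); [ring | rewrite c4E; ring].
Qed.

Section Walk.
Variables (R : realType) (d : int -> int -> R) (t : R).
Hypotheses (hd : weights d) (ht : 0 < t < 1).
Hypotheses (hd1 : d (-1) 1 != 0) (hd2 : d 1 (-1) != 0).
Hypotheses (hd3 : d (-1) (-1) = 0) (hd4 : d (-1) 0 = 0) (hd5 : d 0 (-1) = 0).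

Let a : R[i] := (t * d (-1) 1)%:C.
Let b : R[i] := (t * d 1 (-1))%:C.
Let c : R[i] := (1 - t * d 0 0)%:C.
Let e : R[i] := (t * d 0 1)%:C.
Let f : R[i] := (t * d 1 0)%:C.
Let g : R[i] := (t * d 1 1)%:C.

Lemma sum_steps (A : nmodType) (G : int -> int -> nat -> nat -> A) :
  \sum_(i < 3) \sum_(j < 3) G (i%:Z - 1) (j%:Z - 1) i j =
  G (-1) (-1) 0%N 0%N + G (-1) 0 0%N 1%N + G (-1) 1 0%N 2%N +
  (G 0 (-1) 1%N 0%N + G 0 0 1%N 1%N + G 0 1 1%N 2%N) +
  (G 1 (-1) 2%N 0%N + G 1 0 2%N 1%N + G 1 1 2%N 2%N).
Proof. by rewrite !big_ord_recr !big_ord0 /= !add0r. Qed.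

Lemma kernel_curveE : kernel_curve d t = conic_curve a b c e f g.
Proof.
apply: funext => p; rewrite /kernel_curve /conic_curve; congr (_ = 0).
rewrite /Kbar (sum_steps (fun k l i j =>
  (d k l)%:C * _ ^+ i * _ ^+ (2 - i) * _ ^+ j * _ ^+ (2 - j))).
rewrite hd3 hd4 hd5 /conic_form /a /b /c /e /f /g; ring.
Qed.

Lemma kernelE : kernel d t = conic_kernel a b c e f g.
Proof.
rewrite /kernel (sum_steps (fun k l i j =>
  ((d k l)%:C)%:P%:P * 'X ^+ i * 'Y ^+ j)).
pose k (z : R) : {poly {poly R[i]}} := (z%:C)%:P%:P.
have kM z z' : ((z * z')%:C)%:P%:P = k z * k z' by rewrite rmorphM !polyCM.
have cE : c%:P%:P = 1 - k t * k (d 0 0).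
  have -> : c = 1 - t%:C * (d 0 0)%:C by rewrite /c rmorphB rmorph1 rmorphM.
  by rewrite !polyCB !polyCM !polyC1.
rewrite hd3 hd4 hd5 /conic_kernel cE !kM.
have k0 : ((0 : R)%:C)%:P%:P = 0 :> {poly {poly R[i]}} by rewrite !polyC0.
rewrite k0 -!/(k _).
move: (k t) (k (d 0 0)) (k (d 0 1)) (k (d 1 0)) (k (d 1 1)) (k (d (-1) 1)).
by move: (k (d 1 (-1))) => *; ring.
Qed.

Lemma weight_ge0 i j : i \in steps -> j \in steps -> 0 <= d i j.
Proof. by move=> hi hj; have /andP[] := hd.1 i j hi hj. Qed.

(** As t < 1 and the weights are nonnegative of sum 1,
    t (d_{-1,1} + d_{1,-1}) <= t (1 - d_{0,0}) < 1 - t d_{0,0}; then compare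
    squares by the inequality of arithmetic and geometric means. *)
Lemma alpha2_gt0 : 0 < alpha2 d t.
Proof.
have /andP[t0 t1] := ht.
have := hd.2; rewrite /steps !big_cons !big_nil hd3 hd4 hd5 /alpha2.
have : 0 <= d (-1) 1 by apply: weight_ge0.
have : 0 <= d 1 (-1) by apply: weight_ge0.
have : 0 <= d 0 0 by apply: weight_ge0.
have : 0 <= d 0 1 by apply: weight_ge0.
have : 0 <= d 1 0 by apply: weight_ge0.
have : 0 <= d 1 1 by apply: weight_ge0.
move: (d 0 0) (d 0 1) (d 1 0) (d 1 1) (d (-1) 1) (d 1 (-1)).
move=> x00 x01 x10 x11 x y h11 h10 h01 h00 hy hx hs.
have h : t * (x + y) < 1 - t * x00.
  have : t * (x + y + x00) <= t * 1 by rewrite ler_pM2l //; lra.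
  by lra.
have h' : (t * (x + y)) ^+ 2 < (1 - t * x00) ^+ 2.
  by rewrite ltr_pXn2r // ?nnegrE; nra.
have := sqr_ge0 (t * (x - y)).
by move: h'; nra.
Qed.

Lemma discE : disc a b c = (alpha2 d t)%:C.
Proof. rewrite /disc /alpha2 /a /b /c; ring. Qed.
Lemma al3E : al3 b c e f = (alpha3 d t)%:C.
Proof. rewrite /al3 /alpha3 /b /c /e /f; ring. Qed.
Lemma al4E : al4 b f g = (alpha4 d t)%:C.
Proof. rewrite /al4 /alpha4 /b /g /f; ring. Qed.
Lemma be3E : be3 a c e f = (beta3 d t)%:C.
Proof. rewrite /be3 /beta3 /a /c /e /f; ring. Qed.
Lemma be4E : be4 a e g = (beta4 d t)%:C.
Proof. rewrite /be4 /beta4 /a /e /g; ring. Qed.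


Lemma iota1_affine (iota : P1 R[i] * P1 R[i] -> P1 R[i] * P1 R[i]) (x y : R[i]) :
  is_iota1 d t iota -> conic_curve a b c e f g (Some x, Some y) ->
  x != 0 -> y != 0 -> a / x + e + g * x != 0 ->
  iota (Some x, Some y) =
    (Some x, Some (b * x / ((a / x + e + g * x) * y))).
Proof.
move=> [_ hi]; rewrite -kernel_curveE // => hE x0 y0.
have t0 : t%:C != 0 :> R[i] by rewrite fmorph_eq0 gt_eqF //; case/andP: ht.
have -> : a / x + e + g * x = t%:C * coefA d 1 x.
  rewrite /coefA /steps !big_cons big_nil exprN1 expr0z expr1z /a /e /g.
  by field.
have -> : b * x = t%:C * coefA d (-1) x.
  rewrite /coefA /steps !big_cons big_nil exprN1 expr0z expr1z hd3 hd5 /b.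
  by field.
rewrite mulf_eq0 (negPf t0) /= => A0; rewrite hi //.
by rewrite -[t%:C * _ * y]mulrA -mulf_div divff // mul1r.
Qed.

Lemma iota2_affine (iota : P1 R[i] * P1 R[i] -> P1 R[i] * P1 R[i]) (x y : R[i]) :
  is_iota2 d t iota -> conic_curve a b c e f g (Some x, Some y) ->
  x != 0 -> y != 0 -> b / y + f + g * y != 0 ->
  iota (Some x, Some y) =
    (Some (a * y / ((b / y + f + g * y) * x)), Some y).
Proof.
move=> [_ hi]; rewrite -kernel_curveE // => hE x0 y0.
have t0 : t%:C != 0 :> R[i] by rewrite fmorph_eq0 gt_eqF //; case/andP: ht.
have -> : b / y + f + g * y = t%:C * Defs.coefB d 1 y.
  rewrite /Defs.coefB /steps !big_cons big_nil exprN1 expr0z expr1z /b /f /g.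
  by field.
have -> : a * y = t%:C * Defs.coefB d (-1) y.
  rewrite /Defs.coefB /steps !big_cons big_nil exprN1 expr0z expr1z hd3 hd4 /a.
  by field.
rewrite mulf_eq0 (negPf t0) /= => B0; rewrite hi //.
by rewrite -[t%:C * _ * x]mulrA -mulf_div divff // mul1r.
Qed.

Hypothesis hnd : ~ degenerate d t.

Lemma a_neq0 : a != 0.
Proof. by rewrite fmorph_eq0 mulf_neq0 // gt_eqF //; case/andP: ht. Qed.

Lemma b_neq0 : b != 0.
Proof. by rewrite fmorph_eq0 mulf_neq0 // gt_eqF //; case/andP: ht. Qed.

Lemma disc_neq0 : disc a b c != 0.
Proof. by rewrite discE fmorph_eq0 gt_eqF // alpha2_gt0. Qed.

Lemma det_neq0 : det a b c e f g != 0.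
Proof.
apply: contra_not_neq hnd => W0; apply: Or31; rewrite kernelE.
by apply: conic_kernel_reducible => //; [exact: a_neq0 | exact: disc_neq0].
Qed.

End Walk.

(** * The parametrization *)

Unset Implicit Arguments.
Set Strict Implicit.

Theorem proposition4p7 (R : realType) (d : int -> int -> R) (t : R)
    (hd : weights d)
    (ht : 0 < t < 1)
    (ht_tr : transcendental_over (weight_field d) t)
    (hnd : ~ degenerate d t)
    (hd1 : d (-1) 1 != 0) (hd2 : d 1 (-1) != 0)
    (hd3 : d (-1) (-1) = 0) (hd4 : d (-1) 0 = 0) (hd5 : d 0 (-1) = 0)
    (iota1 iota2 : P1 R[i] * P1 R[i] -> P1 R[i] * P1 R[i])
    (hiota1 : is_iota1 d t iota1) (hiota2 : is_iota2 d t iota2)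
    (ra rb : R[i]) :
  let a2 := (alpha2 d t)%:C in
  let a3 := (alpha3 d t)%:C in
  let a4 := (alpha4 d t)%:C in
  let b2 := (beta2 d t)%:C in
  let b3 := (beta3 d t)%:C in
  let b4 := (beta4 d t)%:C in
  (* ra and rb are square roots of the two discriminants *)
  ra ^+ 2 = a3 ^+ 2 - 4 * a2 * a4 ->
  rb ^+ 2 = b3 ^+ 2 - 4 * b2 * b4 ->
  exists (lambda q : R[i]) (phi : P1 R[i] -> P1 R[i] * P1 R[i]),
    let x s := (phi s).1 in
    let y s := (phi s).2 in
    [/\ lambda != 0 /\ q = lambda ^+ 2,
        parametrization (kernel_curve d t) phi,
        (forall s : R[i], s != 0 ->
           phi (Some s) =
             (pt (4 * a2) (ra * (s + 1 / s) - 2 * a3),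
              pt (4 * b2) (rb * (s / lambda + lambda / s) - 2 * b3))),
        [/\ induces phi iota1 (invP1 1),
            induces phi iota2 (invP1 q)
          & induces phi (fun p => iota2 (iota1 p)) (scaleP1 q)]
      & [/\ x (Some 0) = pt 0 1 /\ x None = pt 0 1,
            (* the labelling of the roots, when a4 = 0, supposes that the
               square root of a3 ^+ 2 is a3 *)
            (a4 != 0 \/ ra = a3 ->
               x (Some 1) = root3 a3 a4 ra /\
               x (Some (-1)) = root4 a2 a3 a4 ra),
            y (Some 0) = pt 0 1 /\ y None = pt 0 1
          & (b4 != 0 \/ rb = b3 ->
               y (Some lambda) = root3 b3 b4 rb /\
               y (Some (- lambda)) = root4 b2 b3 b4 rb)]].
Proof.
move=> a2 a3 a4 b2 b3 b4.
pose a : R[i] := (t * d (-1) 1)%:C; pose b : R[i] := (t * d 1 (-1))%:C.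
pose c : R[i] := (1 - t * d 0 0)%:C; pose e : R[i] := (t * d 0 1)%:C.
pose f : R[i] := (t * d 1 0)%:C; pose g : R[i] := (t * d 1 1)%:C.
have a2E : disc a b c = a2 := discE d t.
have a3E : al3 b c e f = a3 := al3E d t.
have a4E : al4 b f g = a4 := al4E d t.
have b3E : be3 a c e f = b3 := be3E d t.
have b4E : be4 a e g = b4 := be4E d t.
have a0 : a != 0 := a_neq0 ht hd1.
have b0 : b != 0 := b_neq0 ht hd2.
have D0 : disc a b c != 0 := disc_neq0 hd ht hd3 hd4 hd5.
have W0 : det a b c e f g != 0 := det_neq0 hd ht hd1 hd3 hd4 hd5 hnd.
have b2E : b2 = a2 by [].
move=> hra hrb.
have ra2 : ra ^+ 2 = 16 * b * det a b c e f g.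
  by rewrite hra -a2E -a3E -a4E al_discE.
have rb2 : rb ^+ 2 = 16 * a * det a b c e f g.
  by rewrite hrb b2E -a2E -b3E -b4E be_discE.
have [lam [lamb lama]] := exists_lambda a0 b0 W0 ra2 rb2.
have l0 := lam_neq0 a0 b0 W0 rb2 lamb.
pose phi := par a b c e f ra rb lam.
have phiE (s : R[i]) : s != 0 -> phi (Some s) =
    (pt (4 * a2) (ra * (s + 1 / s) - 2 * a3),
     pt (4 * b2) (rb * (s / lam + lam / s) - 2 * b3)).
  move=> s0; rewrite /phi /par /xpar /ypar !qmap_affine // a2E a3E b3E b2E.
  rewrite -[X in _ = (_, X)](@pt_scale _ lam) //.
  by congr (pt _ _, pt _ _); field; rewrite ?s0 ?l0.
have curveE := kernel_curveE t hd3 hd4 hd5.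
have lift1 : induces phi iota1 (invP1 1).
  have [[_ r1 r2 _] _] := hiota1; rewrite curveE in r1 r2.
  apply: (iota1_lift a0 b0 D0 W0 ra2 rb2 lamb lama r1 r2) => u v.
  exact: iota1_affine.
have lift2 : induces phi iota2 (invP1 (lam ^+ 2)).
  have [[_ r1 r2 _] _] := hiota2; rewrite curveE in r1 r2.
  apply: (iota2_lift a0 b0 D0 W0 ra2 rb2 lamb lama r1 r2) => u v.
  exact: iota2_affine.
have a20 : a2 != 0 by rewrite -a2E.
have lift21 : induces phi (fun p => iota2 (iota1 p)) (scaleP1 (lam ^+ 2)).
  by move=> s; rewrite -invP1_comp ?expf_neq0 // lift2 lift1.
exists lam, (lam ^+ 2), phi => x y; split.
- by split.
- by rewrite curveE; exact: (par_parametrization a0 b0 D0 W0 ra2 rb2 lamb lama).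
- exact: phiE.
- split; [exact: lift1 | exact: lift2 | exact: lift21].
split.
- exact: (xpar_ends b0 W0 ra2).
- move=> h; have [<- <-] := roots_of_discriminant a20 hra h.
  by rewrite /x !phiE ?oppr_eq0 ?oner_eq0 //; split; congr pt; field.
- exact: (ypar_ends a0 b0 W0 rb2 lamb).
- move=> h; have [<- <-] := roots_of_discriminant (a20 : b2 != 0) hrb h.
  by rewrite /y !phiE ?oppr_eq0 //; split; congr pt; field.
Qed.
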